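(* If $(t_k)$ and $(\tau_k)$, $k=0,1,2,\ldots$, are a binomial-transform pair of the first kind, then so are the sequences \[ a_k=\frac{1}{(k+1)(k+2)}\sum_{j=0}^k t_j\quad\text{and}\quad \alpha_k=\frac{1}{(k+1)(k+2)}\sum_{j=0}^k\tau_j,\qquad k=0,1,2,\ldots. \]
   Context: Two sequences $(t_k)_{k\ge0}$ and $(\tau_k)_{k\ge0}$ of complex numbers form a binomial-transform pair of the first kind if $\tau_n=\sum_{k=0}^n(-1)^k\binom nk t_k$ for every non-negative integer $n$. *)

(* Defs.v *)
From mathcomp Require Import all_boot all_order all_algebra.
From mathcomp Require Import complex.
From mathcomp Require Import reals.

Set Implicit Arguments.
Unset Strict Implicit.
Unset Printing Implicit Defensive.

Import GRing.Theory.
Local Open Scope ring_scope.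

(* A realType is a model of the real numbers, so R[i] is the field of complex
   numbers.  The pair is of the first kind: the sign (-1)^k is inside the sum. *)
Definition binomial_pair1 (R : realType) (t tau : nat -> R[i]) : Prop :=
  forall n : nat,
    tau n = \sum_(0 <= k < n.+1) (-1) ^+ k * 'C(n, k)%:R * t k.

(* Main.v *)
(** Pascal's rule turns the partial sums of [tau] into
    [\sum_k (-1)^k C(n+1, k+1) t_k].  On the other side,
    [C(n, k) / ((k+1)(k+2)) = C(n+2, k+2) / ((n+1)(n+2))], and summation by parts
    reduces [\sum_k (-1)^k C(n+2, k+2) (t_0 + ... + t_k)] to the same sum. *)
Require Import Defs.
From mathcomp Require Import all_boot all_order all_algebra.
From mathcomp Require Import complex.
From mathcomp Require Import reals.
From mathcomp Require Import ring.

Import GRing.Theory.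
Local Open Scope ring_scope.

(** Induction on [n]: Pascal's rule splits [C(n+1, k+1)], and the part with [C(n, k)] sums to
    [tau n]. *)
Lemma sum_binomial_transform (R : comNzRingType) (t tau : nat -> R) (n : nat) :
  (forall m, tau m = \sum_(0 <= k < m.+1) (-1) ^+ k * 'C(m, k)%:R * t k) ->
  \sum_(0 <= j < n) tau j
  = \sum_(0 <= k < n) (-1) ^+ k * 'C(n, k.+1)%:R * t k.
Proof.
move=> tauE; elim: n => [|n IHn]; first by rewrite !big_geq.
under [RHS]eq_bigr => k _ do rewrite binS natrD mulrDr mulrDl.
rewrite big_nat_recr //= {}IHn tauE big_split /=; congr (_ + _).
(* The other part has one extra term, at [k = n], where [C(n, n+1) = 0]. *)
by rewrite [RHS]big_nat_recr //= bin_small // mulr0 mul0r addr0.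
Qed.

(** The cut-off [m] is kept independent of [n] so that induction runs on [m] alone; the second
    summand is the boundary term, zero once [m >= n]. *)
Lemma sum_by_parts_binomial (R : comNzRingType) (t : nat -> R) (n m : nat) :
  \sum_(0 <= k < m) (-1) ^+ k * 'C(n.+1, k.+2)%:R * (\sum_(0 <= j < k.+1) t j)
    + (-1) ^+ m * 'C(n, m.+1)%:R * (\sum_(0 <= j < m) t j)
  = \sum_(0 <= k < m) (-1) ^+ k * 'C(n, k.+1)%:R * t k.
Proof.
elim: m => [|m IHm]; first by rewrite !big_geq // mulr0 addr0.
rewrite !(big_nat_recr m) //= -IHm binS natrD exprS.
by ring.
Qed.

(** Absorption, [(n+1) C(n, k) = (k+1) C(n+1, k+1)], applied twice. *)
Lemma bin_div_succ_succ (F : numFieldType) (n k : nat) :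
  'C(n, k)%:R / ((k%:R + 1) * (k%:R + 2))
  = 'C(n.+2, k.+2)%:R / ((n%:R + 1) * (n%:R + 2)) :> F.
Proof.
have absorb : (n.+1 * n.+2 * 'C(n, k) = k.+1 * k.+2 * 'C(n.+2, k.+2))%N.
  rewrite mulnAC (mul_bin_diag n.+1) mulnAC -[RHS]mulnA.
  by rewrite -(mul_bin_diag n.+2) mulnA.
have neq0 (m : nat) : (m%:R + 1) * (m%:R + 2) != 0 :> F.
  by rewrite natr1 -natrD addn2 -natrM Num.Theory.pnatr_eq0.
apply/eqP; rewrite eqr_div //; apply/eqP.
rewrite !natr1 -!natrD -!natrM !addn2; congr _%:R.
by rewrite mulnC absorb mulnC.
Qed.

Theorem theorem16 (R : realType) (t tau : nat -> R[i])
    (htau : binomial_pair1 t tau) :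
  binomial_pair1
    (fun k : nat =>
       1 / ((k%:R + 1) * (k%:R + 2)) * \sum_(0 <= j < k.+1) t j)
    (fun k : nat =>
       1 / ((k%:R + 1) * (k%:R + 2)) * \sum_(0 <= j < k.+1) tau j).
Proof.
move=> n; rewrite (sum_binomial_transform _ _ _ _ htau).
(* Both parameters are [n+1] here, so the boundary term contains [C(n+1, n+2) = 0]. *)
rewrite -sum_by_parts_binomial bin_small // mulr0 mul0r addr0 mulr_sumr.
apply: eq_bigr => k _; rewrite !mulrA !mulr1 -[_ * _ / _]mulrA.
by rewrite bin_div_succ_succ; ring.
Qed.
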